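(* Let $P\subset\mathbb{R}^d$ be a rational $d$-polytope containing an interior point $\mathbf{a}/\ell$ with $\mathbf{a}\in\mathbb{Z}^d$, $\ell\in\mathbb{Z}_{>0}$. Fix a boundary triangulation $T$ of $P$ with denominator $q$, and define $h^*(P;z)$ by $\mathrm{Ehr}(P;z)=\frac{h^*(P;z)}{(1-z^q)^{d+1}}$. Then $$h^*(P;z)=\frac{1-z^q}{1-z^\ell}\sum_{\Omega\in T}\big(B(\Omega;z)+B(\Omega';z)\big)\,h(\Omega;z^q),$$ the sum over all simplices of $T$ including the empty simplex.
   Context: $\mathrm{Ehr}(P;z)=\sum_{t\ge0}|tP\cap\mathbb{Z}^d|z^t$. A boundary triangulation $T$ of $P$ is a simplicial complex of simplices (including the empty simplex, of dimension $-1$) whose union is $\partial P$; its denominator $q$ is the lcm of vertex coordinate denominators of its simplices. Let $u$ be the last-coordinate projection on $\mathbb{R}^{d+1}$. For linearly independent $\mathbf{W}\subset\mathbb{Z}^{d+1}$, $B(\mathbf{W};z)=\sum z^{u(\mathbf{v})}$ over integer points $\mathbf{v}$ of $\{\sum_{\mathbf{w}\in\mathbf{W}}\lambda_{\mathbf{w}}\mathbf{w}:0<\lambda_{\mathbf{w}}<1\}$ ($0$ if none; $B(\emptyset;z)=1$). For $\Omega\in T$ with vertices $\mathbf{r}_1/q,\dots,\mathbf{r}_{m+1}/q$ ($\mathbf{r}_i\in\mathbb{Z}^d$), let $\mathbf{W}=\{(\mathbf{r}_i,q)\}$, $B(\Omega;z)=B(\mathbf{W};z)$ and $B(\Omega';z)=B(\mathbf{W}\cup\{(\mathbf{a},\ell)\};z)$;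 thus $B(\emptyset;z)=1$ and $B(\emptyset';z)=B(\{(\mathbf{a},\ell)\};z)$. The $h$-polynomial for the boundary triangulation is $h(\Omega;z)=(1-z)^{d-1-\dim\Omega}\sum_{\Omega\subseteq\Phi\in T}\left(\frac{z}{1-z}\right)^{\dim\Phi-\dim\Omega}$. *)

(* Defs.v *)
From HB Require Import structures.
From mathcomp Require Import all_boot all_order all_algebra.
From mathcomp Require Import finmap.
From mathcomp Require Import all_classical all_reals topology normedtype.

Set Implicit Arguments.
Unset Strict Implicit.
Unset Printing Implicit Defensive.

Import Order.TTheory GRing.Theory Num.Theory.
Import numFieldNormedType.Exports.

Local Open Scope classical_set_scope.
Local Open Scope ring_scope.

(* Formal power series in one variable. For a commutative ring R with units,
   [fps R] is the ring R[[z]] with the Cauchy product; its units are the series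
   with invertible constant term, so that quotients by 1 - z^n (n > 0) are the
   usual quotients in R[[z]]. *)
Record fps (R : Type) := Fps { fcoef : nat -> R }.

Section FpsZmod.
Variable R : zmodType.
Implicit Types f g h : fps R.

HB.instance Definition _ := [isNew for @fcoef R].
HB.instance Definition _ := [Choice of fps R by <:].

Lemma fpsP f g : (forall n, fcoef f n = fcoef g n) <-> f = g.
Proof. by case: f g => f [g]; split=> [/= /funext-> | ->]. Qed.

Definition fps_zero : fps R := Fps (fun=> 0).
Definition fps_opp f : fps R := Fps (fun n => - fcoef f n).
Definition fps_add f g : fps R := Fps (fun n => fcoef f n + fcoef g n).

Lemma fps_addA : associative fps_add.
Proof. by move=> f g h; apply/fpsP => n /=; rewrite addrA. Qed.
Lemma fps_addC : commutative fps_add.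
Proof. by move=> f g; apply/fpsP => n /=; rewrite addrC. Qed.
Lemma fps_add0 : left_id fps_zero fps_add.
Proof. by move=> f; apply/fpsP => n /=; rewrite add0r. Qed.
Lemma fps_addN : left_inverse fps_zero fps_opp fps_add.
Proof. by move=> f; apply/fpsP => n /=; rewrite addNr. Qed.

HB.instance Definition _ := GRing.isZmodule.Build (fps R)
  fps_addA fps_addC fps_add0 fps_addN.

End FpsZmod.

Section FpsRing.
Variable R : comNzRingType.
Implicit Types f g h : fps R.

Definition fps_one : fps R := Fps (fun n => (n == 0%N)%:R).
Definition fps_mul f g : fps R :=
  Fps (fun n => \sum_(i < n.+1) fcoef f i * fcoef g (n - i)%N).

Let trunc f n : {poly R} := \poly_(i < n.+1) fcoef f i.

Let coef_trunc f n i : (i <= n)%N -> (trunc f n)`_i = fcoef f i.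
Proof. by move=> le_in; rewrite coef_poly ltnS le_in. Qed.

Let fps_mulE f g n m : (m <= n)%N ->
  fcoef (fps_mul f g) m = (trunc f n * trunc g n)`_m.
Proof.
move=> le_mn; rewrite coefM; apply: eq_bigr => -[i /=]; rewrite ltnS => le_im _.
by rewrite !coef_trunc ?(leq_trans (leq_subr _ _)) ?(leq_trans le_im).
Qed.

Lemma fps_mulA : associative fps_mul.
Proof.
move=> f g h; apply/fpsP => n.
transitivity ((trunc f n * (trunc g n * trunc h n))`_n).
  rewrite coefM; apply: eq_bigr => -[i /=]; rewrite ltnS => le_in _.
  by rewrite coef_trunc // -fps_mulE // leq_subr.
rewrite mulrA coefM; apply: eq_bigr => -[i /=]; rewrite ltnS => le_in _.
by rewrite coef_trunc ?leq_subr // -fps_mulE.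
Qed.
Lemma fps_mulC : commutative fps_mul.
Proof. by move=> f g; apply/fpsP => n; rewrite !(fps_mulE _ _ (leqnn n)) mulrC. Qed.
Lemma fps_mul1 : left_id fps_one fps_mul.
Proof.
move=> f; apply/fpsP => n /=; rewrite big_ord_recl /= mul1r subn0.
by rewrite big1 ?addr0 // => i _; rewrite mul0r.
Qed.
Lemma fps_mulD : left_distributive fps_mul (@fps_add R).
Proof.
move=> f g h; apply/fpsP => n /=; rewrite -big_split /=.
by apply: eq_bigr => i _; rewrite mulrDl.
Qed.
Lemma fps_1neq0 : fps_one != 0.
Proof. by apply/eqP => /fpsP /(_ 0%N) /eqP; rewrite oner_eq0. Qed.

HB.instance Definition _ := GRing.Zmodule_isComNzRing.Build (fps R)
  fps_mulA fps_mulC fps_mul1 fps_mulD fps_1neq0.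

Definition fpsX : fps R := Fps (fun n => (n == 1%N)%:R).

End FpsRing.

Section FpsUnit.
Variable R : comUnitRingType.
Implicit Types f g : fps R.

Definition fps_unit : {pred fps R} := [pred f | fcoef f 0 \is a GRing.unit].

(* The first n.+1 coefficients of 1 / f. *)
Fixpoint fps_inv_seq f n : seq R :=
  if n is m.+1 then
    let s := fps_inv_seq f m in
    rcons s (- (fcoef f 0)^-1 * \sum_(i < m.+1) fcoef f i.+1 * s`_(m - i))
  else [:: (fcoef f 0)^-1].

Definition fps_inv f : fps R :=
  if f \in fps_unit then Fps (fun n => (fps_inv_seq f n)`_n) else f.

Let size_inv f n : size (fps_inv_seq f n) = n.+1.
Proof. by elim: n => //= n IHn; rewrite size_rcons IHn. Qed.

Let nth_inv f n i : (i <= n)%N -> (fps_inv_seq f n)`_i = (fps_inv_seq f i)`_i.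
Proof.
elim: n => [|n IHn]; first by rewrite leqn0 => /eqP->.
rewrite leq_eqVlt => /predU1P[-> //|]; rewrite ltnS => le_in.
by rewrite /= nth_rcons size_inv ltnS le_in IHn.
Qed.

Lemma fps_mulV : {in fps_unit, left_inverse 1 fps_inv *%R}.
Proof.
move=> f Uf; rewrite mulrC; apply/fpsP => n.
rewrite /fps_inv Uf /=; case: n => [|n]; first by rewrite big_ord1 divrr.
rewrite big_ord_recl subn0 /= nth_rcons size_inv ltnn eqxx.
rewrite mulNr mulrN mulVKr //; apply/eqP; rewrite addrC subr_eq0; apply/eqP.
apply: eq_bigr => i _; rewrite /bump /= add1n subSS.
by rewrite [X in _ = _ * X]nth_inv ?leq_subr.
Qed.
Lemma fps_unitPl f g : g * f = 1 -> fps_unit f.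
Proof.
move=> /fpsP /(_ 0%N) /=; rewrite big_ord1 => gf1.
by apply/unitrPr; exists (fcoef g 0); rewrite mulrC.
Qed.
Lemma fps_inv_out : {in [predC fps_unit], fps_inv =1 id}.
Proof. by move=> f /negbTE nUf; rewrite /fps_inv nUf. Qed.

HB.instance Definition _ := GRing.ComNzRing_hasMulInverse.Build (fps R)
  fps_mulV fps_unitPl fps_inv_out.

End FpsUnit.

Section Polytopes.
Variables (R : realType) (d : nat).
Implicit Types (V : {fset 'rV[rat]_d}) (P : set 'rV[R]_d).

(* Finite sets of rational points carry real convex and affine combinations. *)
Definition conv_hull V : set 'rV[R]_d :=
  [set x | exists lam : 'rV[rat]_d -> R,
    [/\ forall v, v \in V -> 0 <= lam v,
        \sum_(v <- V) lam v = 1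
      & x = \sum_(v <- V) lam v *: map_mx ratr v]].

Definition aff_hull V : set 'rV[R]_d :=
  [set x | exists lam : 'rV[rat]_d -> R,
    \sum_(v <- V) lam v = 1 /\ x = \sum_(v <- V) lam v *: map_mx ratr v].

Definition aff_indep V :=
  forall lam : 'rV[rat]_d -> R,
    \sum_(v <- V) lam v = 0 -> \sum_(v <- V) lam v *: map_mx ratr v = 0 ->
    forall v, v \in V -> lam v = 0.

Definition rational_dpolytope P :=
  exists V, P = conv_hull V /\ aff_hull V = setT.

Definition boundary P : set 'rV[R]_d := closure P `\` interior P.

(* A simplex is given by its (rational) vertex set: its faces are the subsets,
   and [fset0] is the empty simplex, whose convex hull is the empty set. *)
Definition boundary_triangulation P (T : {fset {fset 'rV[rat]_d}}) :=
  [/\ fset0 \in T,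
      forall Om, Om \in T -> aff_indep Om,
      forall Om Phi : {fset 'rV[rat]_d},
        Om \in T -> (Phi `<=` Om)%fset -> Phi \in T,
      forall Om Phi : {fset 'rV[rat]_d}, Om \in T -> Phi \in T ->
        exists Psi : {fset 'rV[rat]_d},
          [/\ (Psi `<=` Om)%fset, (Psi `<=` Phi)%fset
            & conv_hull Om `&` conv_hull Phi = conv_hull Psi]
    & \bigcup_(Om in [set` T]) conv_hull Om = boundary P].

(* |tP /\ Z^d|; for bounded P the set is finite, otherwise [fset_set] is empty. *)
Definition lattice_count P (t : nat) : nat :=
  #|` fset_set [set v : 'rV[int]_d |
                 [set t%:R *: x | x in P] (map_mx intr v)] |.

Definition Ehr P : fps rat := Fps (fun t => (lattice_count P t)%:R).

(* Integer points of the open parallelepiped spanned by W in R^(d+1). *)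
Definition open_box (W : {fset 'rV[int]_(d + 1)}) : set 'rV[int]_(d + 1) :=
  [set v | exists lam : 'rV[int]_(d + 1) -> R,
    (forall w, w \in W -> 0 < lam w < 1) /\
    map_mx intr v = \sum_(w <- W) lam w *: map_mx intr w].

End Polytopes.

Definition last_coord d (v : 'rV[int]_(d + 1)) : int := v 0 (rshift d 0).

(* The sum runs over a finite set when W is linearly independent; when the last
   coordinates of W are positive, all the exponents are nonnegative. *)
Definition box_series (R : realType) (K : unitRingType) d
    (W : {fset 'rV[int]_(d + 1)}) (z : K) : K :=
  \sum_(v \in open_box R W) z ^ last_coord v.

Section Triangulations.
Variables (d : nat) (T : {fset {fset 'rV[rat]_d}}).
Implicit Types Om Phi : {fset 'rV[rat]_d}.

Definition denominator : nat :=
  \big[lcmn/1%N]_(Om <- T) \big[lcmn/1%N]_(v <- Om)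
    \big[lcmn/1%N]_(i < d) absz (denq (v 0 i)).

Definition sdim Om : int := (#|` Om |)%:Z - 1.

Definition hpoly (K : unitRingType) Om (z : K) : K :=
  (1 - z) ^ (d%:Z - 1 - sdim Om) *
  \sum_(Phi <- T | (Om `<=` Phi)%fset) (z / (1 - z)) ^ (sdim Phi - sdim Om).

End Triangulations.

Definition lift_point d (a : 'rV[int]_d) (l : nat) : 'rV[int]_(d + 1) :=
  row_mx a (const_mx l%:Z).

(* The vectors (r, q) for the vertices r / q of Om; when q clears the
   denominators of v, q v is integral and equal to its numerator. *)
Definition lift_simplex d (q : nat) (Om : {fset 'rV[rat]_d}) :
    {fset 'rV[int]_(d + 1)} :=
  [fset lift_point (map_mx (fun x => numq (q%:R * x)) v) q | v in Om]%fset.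

(* Main.v *)
Require Import Defs.
From HB Require Import structures.
From mathcomp Require Import all_boot all_order all_algebra.
From mathcomp Require Import finmap.
From mathcomp Require Import all_classical all_reals topology normedtype.
From mathcomp Require Import zify ring lra.

Set Implicit Arguments.
Unset Strict Implicit.
Unset Printing Implicit Defensive.

Import Order.TTheory GRing.Theory Num.Theory.
Import numFieldNormedType.Exports.

Local Open Scope classical_set_scope.
Local Open Scope ring_scope.

(* Coning the boundary triangulation from (a, l) splits the cone over P into the
   half-open cones { sum lam_w w + mu (a, l) : lam_w > 0, mu >= 0 }, one for each
   simplex of T: a ray from the interior point a / l leaves P at exactly one
   boundary point, which lies in the relative interior of exactly one simplex.
   Cutting off the coefficient of one generator w of height h at 1 writes a cone
   with lam_w > 0 as the part with lam_w < 1, plus its own translate by w, plus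
   the translate by w of the cone without w.  On generating functions this is
   (1 - z^h) G = G' + z^h G'', and iterating it over the vertices expands each
   cone into box series of its faces; exchanging the sums over T collects the
   h-polynomials. *)

(** * Monomials and units in the ring of power series *)

Section FpsMonomials.
Variable K : comNzRingType.

Lemma fcoefXn n i : fcoef (fpsX K ^+ n) i = (i == n)%:R.
Proof.
elim: n i => [|n IHn] i; first by [].
rewrite exprS /=; under eq_bigr do rewrite IHn.
case: i => [|i]; first by rewrite big_ord1 mul0r.
rewrite big_ord_recl mul0r add0r big_ord_recl /= mul1r subSS subn0 eqSS.
by rewrite big1 ?addr0 // => j _; rewrite mul0r.
Qed.

Lemma fcoef_mulXn n (f : fps K) i :
  fcoef (fpsX K ^+ n * f) i = if (n <= i)%N then fcoef f (i - n)%N else 0.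
Proof.
rewrite /=; case: leqP => [le_ni|lt_in].
  rewrite (bigD1 (Ordinal (le_ni : (n < i.+1)%N))) //= fcoefXn eqxx mul1r.
  rewrite big1 ?addr0 // => j neq_jn; rewrite fcoefXn.
  by rewrite (negbTE (_ : j != n :> nat)) ?mul0r.
rewrite big1 // => j _; rewrite fcoefXn ltn_eqF ?mul0r //.
exact: leq_ltn_trans (leq_ord j) lt_in.
Qed.

Lemma fcoef_sum (I : Type) (s : seq I) (F : I -> fps K) i :
  fcoef (\sum_(x <- s) F x) i = \sum_(x <- s) fcoef (F x) i.
Proof. by elim: s => [|x s IHs]; rewrite ?big_nil // !big_cons /= IHs. Qed.

End FpsMonomials.

(** For positive [n] the constant term is 1; for [n = 0] the series would vanish. *)
Lemma unit_subXn (K : comUnitRingType) n :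
  (0 < n)%N -> 1 - fpsX K ^+ n \is a GRing.unit.
Proof.
case: n => // n _.
change (fcoef (1 - fpsX K ^+ n.+1) 0 \is a GRing.unit).
rewrite [X in X \is a _](_ : _ = 1 - fcoef (fpsX K ^+ n.+1) 0) //.
by rewrite fcoefXn subr0 unitr1.
Qed.

(** * Generating functions of graded sets of lattice points *)

Lemma finite_bounded_rV n (M : nat) :
  finite_set [set v : 'rV[int]_n | forall j, `|v 0 j| <= M%:Z].
Proof.
(* Coordinates in [-M, M] are shifted by [M] into the finite range 0, ..., 2M. *)
pose f (g : {ffun 'I_n -> 'I_(M + M).+1}) : 'rV[int]_n :=
  \row_j ((g j)%:Z - M%:Z).
apply: (@sub_finite_set _ _ (range f)); last exact/finite_image/finite_finset.
move=> v /= leM; exists [ffun j => inord (absz (v 0 j + M%:Z))] => //.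
apply/rowP => j; rewrite mxE ffunE inordK; have := leM j; lia.
Qed.

Section GeneratingFunction.
Variable d : nat.
Local Notation E := 'rV[int]_(d + 1).
Implicit Types (S : set E) (v w : E).

Definition level (t : nat) : set E := [set v | last_coord v = t%:Z].

(** This makes [gf] a faithful count: no point lies below height 0, and no level is infinite, in
    which case [fset_set] would return the empty set. *)
Definition graded S :=
  (forall v, S v -> 0 <= last_coord v) /\
  forall t, finite_set (S `&` level t).

Definition gf S : fps rat := Fps (fun t => (#|` fset_set (S `&` level t)|)%:R).

Lemma last_coordD v w : last_coord (v + w) = last_coord v + last_coord w.
Proof. by rewrite /last_coord mxE. Qed.

Lemma gradedU S S' : graded S -> graded S' -> graded (S `|` S').
Proof.
move=> [S0 Sf] [S0' Sf']; split=> [v [/S0|/S0']//|t].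
by rewrite setIUl finite_setU.
Qed.

Lemma gfU S S' : graded S -> graded S' -> S `&` S' = set0 ->
  gf (S `|` S') = gf S + gf S'.
Proof.
move=> [_ Sf] [_ Sf'] SS'0; apply/fpsP => t /=.
rewrite setIUl fset_setU //; have := cardfsUI (fset_set (S `&` level t))
  (fset_set (S' `&` level t)).
rewrite -fset_setI // setIACA SS'0 set0I fset_set0 cardfs0 addn0 => ->.
by rewrite natrD.
Qed.

(** Disjointness is phrased as [pieces that meet have the same index], the form in which the
    uniqueness of cone coordinates delivers it. *)
Lemma graded_gf_bigcup (I : eqType) (s : seq I) (F : I -> set E) :
  uniq s -> (forall i, i \in s -> graded (F i)) ->
  (forall i j, i \in s -> j \in s -> F i `&` F j !=set0 -> i = j) ->
  let U := [set v | exists2 i, i \in s & F i v] in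
  graded U /\ gf U = \sum_(i <- s) gf (F i).
Proof.
elim: s => [|i s IHs] /=.
  have -> : [set v | exists2 i, i \in [::] & F i v] = set0.
    by apply/seteqP; split=> // v [].
  split; first by split=> // t; rewrite set0I.
  by rewrite big_nil; apply/fpsP => t /=; rewrite set0I fset_set0 cardfs0.
move=> /andP[i_s uniq_s] grF disj.
have [|j k js ks|grU gfUE] := IHs uniq_s.
- by move=> j js; apply: grF; rewrite inE js orbT.
- by apply: disj; rewrite inE (js, ks) orbT.
have gri : graded (F i) by apply: grF; rewrite inE eqxx.
rewrite big_cons -gfUE -gfU //; last first.
  apply/seteqP; split=> // v [Fiv [j js Fjv]].
  have ij : i = j by apply: disj; rewrite ?inE ?eqxx ?js ?orbT //; exists v.
  by rewrite ij js in i_s.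
have -> : [set v | exists2 j, j \in i :: s & F j v] =
          F i `|` [set v | exists2 j, j \in s & F j v].
  apply/seteqP; split=> v /=.
    move=> [j]; rewrite inE => /predU1P[-> ?|js Fj]; [by left|].
    by right; exists j.
  by case=> [Fi|[j js Fj]]; [exists i|exists j] => //; rewrite in_cons ?eqxx ?js ?orbT.
by split=> //; apply: gradedU.
Qed.

Lemma graded_shift (h : nat) w S :
  last_coord w = h%:Z -> graded S -> graded [set w + v | v in S].
Proof.
move=> wh [S0 Sf]; split=> [_ [v /S0 v0 <-]|t]; first by rewrite last_coordD; lia.
apply: (@sub_finite_set _ _ [set w + v | v in S `&` level (t - h)%N]).
  move=> _ [[v Sv <-]]; rewrite /level /= last_coordD wh => vt.
  by exists v => //; split=> //; move: (S0 _ Sv); rewrite /=; lia.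
exact: finite_image.
Qed.

Lemma gf_shift (h : nat) w S :
  last_coord w = h%:Z -> graded S -> gf [set w + v | v in S] = fpsX rat ^+ h * gf S.
Proof.
move=> wh [S0 Sf]; apply/fpsP => t; rewrite fcoef_mulXn /=.
case: leqP => [le_ht|lt_th].
  have -> : [set w + v | v in S] `&` level t =
            [set w + v | v in S `&` level (t - h)%N].
    apply/seteqP; split=> [_ [[v Sv <-]]|_ [v [Sv vt] <-]]; rewrite /level /= last_coordD wh.
      by move=> vt; exists v => //; split=> //=; lia.
    by split; [exists v | move: vt; rewrite /level /=; lia].
  by rewrite fset_set_image // card_imfset //; apply: addrI.
(* Points of [S] have height at least 0, so the translate has none below [h]. *)
rewrite (_ : _ `&` _ = set0) ?fset_set0 ?cardfs0 //.
apply/seteqP; split=> // _ [[v Sv <-]]; rewrite /level /= last_coordD wh.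
by have := S0 _ Sv; lia.
Qed.

(** Grouping the monomials by height links the integer-exponent sums of [box_series] to [gf]. *)
Lemma gf_finite S : finite_set S -> (forall v, S v -> 0 <= last_coord v) ->
  \sum_(v \in S) fpsX rat ^ last_coord v = gf S.
Proof.
move=> Sf S0; rewrite fsbig_finite //; apply/fpsP => t; rewrite fcoef_sum /=.
have -> : fset_set (S `&` level t) =
          [fset v in fset_set S | last_coord v == t%:Z]%fset.
  apply/fsetP => v; rewrite !inE in_fset_set ?in_fset_set //; last first.
    exact: sub_finite_set Sf.
  rewrite in_setI; congr (_ && _).
  by apply/idP/eqP; rewrite inE.
rewrite card_fset_sum1 natr_sum -big_fset_condE [RHS]big_mkcond /=.
apply: eq_big_seq => v; rewrite in_fset_set // inE => /S0.
by case: (last_coord v) => // n _; rewrite fcoefXn eqz_nat eq_sym; case: eqP.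
Qed.

End GeneratingFunction.

(** * Half-open cones and the cutting of one generator *)

Section HalfOpenCones.
Variables (R : realType) (d : nat).
Local Notation E := 'rV[int]_(d + 1).
Local Notation ev w := (map_mx (intr : int -> R) w).
Local Notation z := (fpsX rat).
Implicit Types (W A : {fset E}) (v w : E) (lam : E -> R).

Definition lin_indep W := forall lam,
  \sum_(w <- W) lam w *: ev w = 0 -> forall w, w \in W -> lam w = 0.

(** [A] collects the generators whose coefficients are already cut off at 1: [A = fset0] gives the
    open cone and [A = W] the open box. *)
Definition halfopen W A : set E := [set v | exists lam,
  [/\ forall w, w \in W -> 0 < lam w, forall w, w \in A -> lam w < 1
    & ev v = \sum_(w <- W) lam w *: ev w]].

Definition pos_heights W := forall w, w \in W -> 0 < last_coord w.

Lemma open_boxE W : open_box R W = halfopen W W.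
Proof.
apply/seteqP; split=> v [lam].
  by move=> [lam01 vE]; exists lam; split=> // w /lam01 /andP[].
move=> [lam0 lam1 vE]; exists lam; split=> // w Ww.
by rewrite lam0 ?lam1.
Qed.

Lemma lin_indep_inj W lam lam' : lin_indep W ->
  \sum_(w <- W) lam w *: ev w = \sum_(w <- W) lam' w *: ev w ->
  forall w, w \in W -> lam w = lam' w.
Proof.
move=> indW eqs w Ww; apply/eqP; rewrite -subr_eq0; apply/eqP.
apply: (indW (fun w => lam w - lam' w)) => //.
under eq_bigr do rewrite scalerBl.
by rewrite sumrB eqs subrr.
Qed.

(** A relation on [W'] extends by zero coefficients to a relation on [W]. *)
Lemma sub_lin_indep W W' : (W' `<=` W)%fset -> lin_indep W -> lin_indep W'.
Proof.
move=> /fsubsetP sW indW lam s0 w W'w.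
have := indW (fun x => if x \in W' then lam x else 0) _ w (sW _ W'w).
rewrite W'w; apply; rewrite -[RHS]s0.
rewrite (eq_bigr (fun x => if x \in W' then lam x *: ev x else 0)); last first.
  by move=> x _; case: ifP => // _; rewrite scale0r.
rewrite -big_mkcond /= big_fset_condE; apply: eq_fbigl => x.
by rewrite !inE /= andb_idl //; apply: sW.
Qed.

Lemma sum_update W lam w r : w \notin W ->
  \sum_(x <- (w |` W)%fset) (if x == w then r else lam x) *: ev x =
  r *: ev w + \sum_(x <- W) lam x *: ev x.
Proof.
move=> w_W; rewrite big_fsetU1 //= eqxx; congr (_ + _).
by apply: eq_big_seq => x Wx; case: eqP => // xw; rewrite -xw Wx in w_W.
Qed.

Lemma last_coord_comb W lam v : ev v = \sum_(w <- W) lam w *: ev w ->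
  (last_coord v)%:~R = \sum_(w <- W) lam w * (last_coord w)%:~R.
Proof.
move=> /matrixP /(_ 0 (rshift d 0)); rewrite mxE summxE /last_coord => ->.
by apply: eq_bigr => w _; rewrite !mxE.
Qed.

Lemma finite_comb W (t : nat) : finite_set [set v | exists lam,
  (forall w, w \in W -> 0 <= lam w <= t%:R) /\ ev v = \sum_(w <- W) lam w *: ev w].
Proof.
(* A crude bound valid for every coordinate at once: each coefficient is at most [t]. *)
pose M := (t * \sum_(w <- W) \sum_j absz (w 0%R j))%N.
apply: sub_finite_set (finite_bounded_rV (d + 1) M) => v [lam [lam0t vE]] j /=.
have := congr1 (fun B : 'rV_(d + 1) => B 0 j) vE; rewrite mxE summxE => vjE.
rewrite -(ler_int R) intr_norm vjE (le_trans (ler_norm_sum _ _ _)) //.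
rewrite -pmulrn /M natrM natr_sum mulr_sumr.
rewrite !big_seq; apply: ler_sum => w Ww.
have /andP[lam0 lamt] := lam0t _ Ww.
rewrite !mxE normrM (ger0_norm lam0) ler_pM //.
rewrite (bigD1 j) //= natrD -intr_norm -abszE -pmulrn.
by rewrite lerDl ler0n.
Qed.

(** Heights of generators are integers, hence at least 1, so at level [t] every coefficient is at
    most [t] and [finite_comb] applies. *)
Lemma graded_halfopen W A : pos_heights W -> graded (halfopen W A).
Proof.
move=> posW; have pos w : w \in W -> 1 <= (last_coord w)%:~R :> R.
  by move=> /posW; rewrite ler1z gtz0_ge1.
have term_ge0 lam w : (forall w, w \in W -> 0 < lam w) -> w \in W ->
    0 <= lam w * (last_coord w)%:~R.
  by move=> l0 Ww; rewrite mulr_ge0 ?ltW ?l0 // (lt_le_trans _ (pos _ Ww)).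
split=> [v [lam [lam0 _ /last_coord_comb vE]]|t].
  by rewrite -(ler_int R) vE big_seq sumr_ge0 // => w; apply: term_ge0.
apply: sub_finite_set (finite_comb W t) => v [[lam [lam0 _ vE]]].
rewrite /level /= => vt; exists lam; split=> // w Ww; rewrite ltW ?lam0 //=.
have := last_coord_comb vE; rewrite vt => tE.
rewrite -[t%:R]/((t%:Z)%:~R) tE (big_fsetD1 w) //=.
rewrite (le_trans (_ : _ <= lam w * (last_coord w)%:~R)) //.
  exact: ler_peMr (ltW (lam0 _ Ww)) (pos _ Ww).
rewrite lerDl big_seq sumr_ge0 // => x; rewrite !inE => /andP[_].
exact: term_ge0.
Qed.

Lemma box_series_gf W : pos_heights W -> box_series R W z = gf (halfopen W W).
Proof.
move=> posW; rewrite /box_series open_boxE gf_finite //.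
  apply: sub_finite_set (finite_comb W 1) => v [lam [lam0 lam1 vE]].
  by exists lam; split=> // w Ww; rewrite !ltW ?lam0 ?lam1.
by case: (graded_halfopen W posW).
Qed.

(* The coefficient of [w] lies in (0,1), equals 1, or exceeds 1. *)
Lemma halfopen_split W A w : w \notin W -> (A `<=` W)%fset ->
  halfopen (w |` W)%fset A = halfopen (w |` W)%fset (w |` A)%fset `|`
    ([set w + v | v in halfopen W A] `|` [set w + v | v in halfopen (w |` W)%fset A]).
Proof.
move=> w_W /fsubsetP sAW.
have neqW x : x \in W -> (x == w) = false.
  by move=> Wx; apply/eqP => xw; rewrite -xw Wx in w_W.
have neqA x : x \in A -> (x == w) = false by move=> /sAW/neqW.
apply/seteqP; split=> v.
  move=> [lam [lam0 lam1 vE]].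
  have vwE : ev (v - w) = (lam w - 1) *: ev w + \sum_(x <- W) lam x *: ev x.
    by rewrite map_mxB vE big_fsetU1 //= scalerBl scale1r addrAC.
  have [lt1|lt1|eq1] := ltgtP (lam w) 1.
  - left; exists lam; split=> // x; rewrite !inE => /predU1P[->//|].
    exact: lam1.
  - right; right; exists (v - w); last by rewrite addrC subrK.
    exists (fun x => if x == w then lam w - 1 else lam x); split.
    + move=> x; rewrite !inE; case: eqP => [->|_ /= Wx]; first by rewrite subr_gt0.
      by apply: lam0; rewrite !inE Wx orbT.
    + by move=> x Ax; rewrite neqA ?lam1.
    + by rewrite sum_update.
  - right; left; exists (v - w); last by rewrite addrC subrK.
    exists lam; split=> //; first by move=> x Wx; apply: lam0; rewrite !inE Wx orbT.
    by rewrite vwE eq1 subrr scale0r add0r.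
case=> [[lam [lam0 lam1 vE]]|[[v' [lam [lam0 lam1 vE]] <-]|[v' [lam [lam0 lam1 vE]] <-]]].
- by exists lam; split=> // x Ax; apply: lam1; rewrite !inE Ax orbT.
- exists (fun x => if x == w then 1 else lam x); split.
  + by move=> x; rewrite !inE; case: eqP => //= _; apply: lam0.
  + by move=> x Ax; rewrite neqA ?lam1.
  + by rewrite sum_update // scale1r map_mxD vE.
- exists (fun x => if x == w then 1 + lam w else lam x); split.
  + move=> x xwW; case: eqP => [_|_]; last exact: lam0.
    by rewrite addr_gt0 ?lam0 // !inE eqxx.
  + by move=> x Ax; rewrite neqA ?lam1.
  + by rewrite sum_update // scalerDl scale1r -addrA map_mxD vE big_fsetU1.
Qed.

(** Linear independence makes the coefficient of [w] well defined, so the three pieces of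
    [halfopen_split] are disjoint and their series add up. *)
Lemma gf_halfopen_split W A w (h : nat) :
  w \notin W -> (A `<=` W)%fset -> lin_indep (w |` W)%fset ->
  pos_heights (w |` W)%fset -> last_coord w = h%:Z ->
  (1 - z ^+ h) * gf (halfopen (w |` W)%fset A) =
  gf (halfopen (w |` W)%fset (w |` A)%fset) + z ^+ h * gf (halfopen W A).
Proof.
move=> w_W sAW ind pos wh.
have posW : pos_heights W by move=> x Wx; apply: pos; rewrite !inE Wx orbT.
have gr1 B := graded_halfopen B pos; have gr2 := graded_halfopen A posW.
have [gs1 gs2] := (graded_shift wh (gr1 A), graded_shift wh gr2).
have memw : w \in (w |` W)%fset by rewrite !inE eqxx.
have coef1 v lam lam' :
    ev v = \sum_(x <- (w |` W)%fset) lam x *: ev x ->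
    ev v = \sum_(x <- (w |` W)%fset) lam' x *: ev x -> lam w = lam' w.
  by move=> -> /(lin_indep_inj ind) ->.
have shift1 v lam : ev v = \sum_(x <- W) lam x *: ev x ->
    ev (w + v) = \sum_(x <- (w |` W)%fset) (if x == w then 1 else lam x) *: ev x.
  by move=> vE; rewrite sum_update // scale1r map_mxD vE.
have shift2 v lam : ev v = \sum_(x <- (w |` W)%fset) lam x *: ev x ->
    ev (w + v) = \sum_(x <- (w |` W)%fset) (if x == w then 1 + lam w else lam x) *: ev x.
  by move=> vE; rewrite sum_update // scalerDl scale1r -addrA map_mxD vE big_fsetU1.
(* The translate of the uncut cone contributes exactly the term subtracted by [1 - z ^+ h]. The
   disjointness claims remain. *)
rewrite mulrBl mul1r {1}halfopen_split // !gfU ?(gf_shift wh) //; first by rewrite addrA addrK.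
(* Between the two translates, the coefficient of [w] is 1 in one and above 1 in the other. *)
- apply/seteqP; split=> // _ [[v [lam [lam0 _ vE]] <-] [v' [lam' [lam0' _ vE']] /addrI vv']].
  rewrite {}vv' in vE'; have /= := coef1 _ _ _ (shift1 _ _ vE) (shift2 _ _ vE').
  by rewrite eqxx => l'0; have := lam0' w memw; lra.
- exact: gradedU.
(* In the cut piece the coefficient of [w] is below 1, in both translates at least 1. *)
apply/seteqP; split=> // y [[lam [lam0 lam1 vE]]].
have lt1 : lam w < 1 by apply: lam1; rewrite !inE eqxx.
move=> [[v' [lam' [lam0' _ vE']] yE]|[v' [lam' [lam0' _ vE']] yE]]; rewrite -yE in vE.
  by have := coef1 _ _ _ vE (shift1 _ _ vE'); rewrite eqxx; lra.
have := coef1 _ _ _ vE (shift2 _ _ vE'); rewrite eqxx.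
by have := lam0' _ memw; lra.
Qed.

End HalfOpenCones.

(** * Expansion of half-open cones into box series of faces *)

Lemma big_fpowersetU1 (M : nmodType) (K : choiceType) (x : K) (B : {fset K})
    (F : {fset K} -> M) : x \notin B ->
  \sum_(Psi <- fpowerset (x |` B)%fset) F Psi =
  \sum_(Psi <- fpowerset B) F Psi + \sum_(Psi <- fpowerset B) F (x |` Psi)%fset.
Proof.
move=> xB; rewrite addrC (big_fsetID _ (fun Psi : {fset K} => x \in Psi)) /=.
congr (_ + _).
  have -> : [fset Psi in fpowerset (x |` B)%fset | x \in Psi]%fset =
            [fset (x |` Psi)%fset | Psi in fpowerset B]%fset.
    apply/fsetP => Psi; rewrite !inE /= fpowersetE; apply/andP/imfsetP => /=.
      move=> [sPsi xPsi]; exists (Psi `\ x)%fset; last by rewrite fsetD1K.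
      rewrite fpowersetE; apply/fsubsetP => y; rewrite !inE => /andP[yx yPsi].
      by have := fsubsetP sPsi _ yPsi; rewrite !inE (negbTE yx).
    move=> [Phi]; rewrite fpowersetE => sPhi ->.
    by rewrite fsetUS // !inE eqxx.
  rewrite big_imfset //= => Phi Phi'; rewrite !fpowersetE.
  move=> /fsubsetP sP /fsubsetP sP' eqP.
  have nx (Psi : {fset K}) : {subset Psi <= B} -> ((x |` Psi) `\ x = Psi)%fset.
    by move=> sPsi; rewrite fsetU1K //; apply: contra xB => /sPsi.
  by rewrite -(nx _ sP) -(nx _ sP') eqP.
apply: eq_fbigl => Psi; rewrite !inE /= !fpowersetE.
apply/andP/fsubsetP => [[/fsubsetP sPsi xPsi] y yPsi|sPsi].
  have := sPsi _ yPsi; rewrite !inE => /predU1P[yx|//].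
  by rewrite -yx yPsi in xPsi.
split; last by apply: contra xB => /sPsi.
by apply/fsubsetP => y /sPsi; rewrite !inE => ->; rewrite orbT.
Qed.

Section HalfOpenExpansion.
Variables (R : realType) (d : nat) (K : choiceType) (f : K -> 'rV[int]_(d + 1)).
Local Notation z := (fpsX rat).

(** Each generator from [B] is either cut, at the cost of a factor 1 / (1 - z^h), or dropped, at the
    cost of z^h / (1 - z^h); [Psi] records the ones that are cut. Indexing through [f] lets the sum
    run over faces of a simplex rather than over sets of lifted vectors. *)
Lemma gf_halfopen_expand (h : nat) (A : {fset 'rV[int]_(d + 1)}) (B : {fset K}) :
  {in B &, injective f} -> (forall x, x \in B -> f x \notin A) -> (0 < h)%N ->
  (forall x, x \in B -> last_coord (f x) = h%:Z) -> pos_heights A ->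
  lin_indep R (A `|` f @` B)%fset ->
  gf (halfopen R (A `|` f @` B)%fset A) = \sum_(Psi <- fpowerset B)
    (1 - z ^+ h)^-1 ^+ #|` Psi| * (z ^+ h / (1 - z ^+ h)) ^+ (#|` B| - #|` Psi|) *
    gf (halfopen R (A `|` f @` Psi)%fset (A `|` f @` Psi)%fset).
Proof.
move=> + + h0; have uz := unit_subXn rat h0.
elim/fset1U_rect: B A => [|x B xB IHB] A.
  move=> _ _ _ _ _; rewrite fpowerset0 big_seq_fset1 imfset0 fsetU0.
  by rewrite cardfs0 !expr0 !mul1r.
move=> injf fA hf posA indf.
have xxB : x \in (x |` B)%fset by rewrite !inE eqxx.
have injB : {in B &, injective f}.
  by move=> y y' yB y'B; apply: injf; rewrite !inE (yB, y'B) orbT.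
have hB y : y \in B -> last_coord (f y) = h%:Z.
  by move=> yB; apply: hf; rewrite !inE yB orbT.
have fxB : f x \notin (f @` B)%fset.
  apply/imfsetP => -[y /= yB fxy]; move: xB.
  by rewrite (injf x y) ?yB // !inE yB orbT.
have eqU : (A `|` f @` (x |` B) = f x |` (A `|` f @` B))%fset.
  by rewrite imfsetU1 fsetUCA.
have eqU' (C : {fset K}) : (f x |` A `|` f @` C = A `|` f @` (x |` C))%fset.
  by rewrite imfsetU1 fsetUCA fsetUA.
have fxU : f x \notin (A `|` f @` B)%fset.
  by rewrite in_fsetU negb_or fA.
have posU : pos_heights (f x |` (A `|` f @` B))%fset.
  move=> w; rewrite !inE => /or3P[/eqP->|/posA//|/imfsetP[y /= yB ->]].
    by rewrite hf.
  by rewrite hB.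
have posxA : pos_heights (f x |` A)%fset.
  by move=> w; rewrite !inE => /predU1P[->|/posA//]; rewrite hf.
rewrite eqU in indf.
have split := gf_halfopen_split fxU (fsubsetUl _ _) indf posU (hf _ xxB).
(* The induction is uniform in [A] because cutting [f x] moves it into the cut set. *)
have IH1 := IHB (f x |` A)%fset injB.
rewrite eqU' eqU in IH1.
have {}IH1 := IH1 _ hB posxA indf.
have IH2 := IHB A injB _ hB posA (sub_lin_indep (fsubsetUr _ _) indf).
rewrite eqU; apply: (mulrI uz); rewrite split IH1 ?IH2; last 2 first.
- by move=> y yB; apply: fA; rewrite !inE yB orbT.
- move=> y yB; rewrite !inE negb_or fA ?inE ?yB ?orbT // andbT.
  by apply: contra fxB => /eqP <-; apply: in_imfset.
rewrite big_fpowersetU1 // addrC mulrDr !mulr_sumr; congr (_ + _).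
  (* Here [x] is dropped: the difference of cardinals grows by one, which supplies the extra z^h /
     (1 - z^h). *)
  apply: eq_big_seq => Psi; rewrite fpowersetE => /fsubset_leq_card lePsi.
  rewrite cardfsU1 xB subSn // exprSr.
  have zE : (1 - z ^+ h) * (z ^+ h / (1 - z ^+ h)) = z ^+ h by rewrite mulrC divrK.
  by rewrite -[X in X * _ = _]zE; ring.
(* Here [x] is cut: the difference of cardinals is unchanged and one more 1 / (1 - z^h) appears. *)
apply: eq_big_seq => Psi; rewrite fpowersetE => sPsi.
have xPsi : x \notin Psi by apply: contra xB => /(fsubsetP sPsi).
rewrite !cardfsU1 xB xPsi /= !add1n subSS exprS eqU' !mulrA.
by rewrite divrr // mul1r.
Qed.

End HalfOpenExpansion.

(** * Segments and rays from an interior point of a convex body *)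

Section ConvexBodies.
Variables (R : realType) (V : normedModType R).
Implicit Types (P : set V) (b c x y : V).

Definition convex_set P := forall x y s,
  P x -> P y -> 0 <= s <= 1 -> P ((1 - s) *: x + s *: y).

(** The homothety with centre [b] and ratio 1 - s carries a ball around [c] inside [P] to a ball
    around the given point, inside [P] by convexity. *)
Lemma interior_segment P c b s : convex_set P -> P° c -> P b -> 0 <= s < 1 ->
  P° (c + s *: (b - c)).
Proof.
move=> cvxP /nbhs_ballP[e /= e0 ceP] Pb /andP[s0 s1].
have s1' : 0 < 1 - s by rewrite subr_gt0.
apply/nbhs_ballP; exists ((1 - s) * e); first exact: mulr_gt0.
move=> y; rewrite -ball_normE /ball_ /= => yball.
(* The preimage of [y] under that homothety. *)
pose y' := (1 - s)^-1 *: (y - s *: b).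
have -> : y = (1 - s) *: y' + s *: b.
  by rewrite /y' scalerA divff ?gt_eqF // scale1r subrK.
apply: cvxP => //; last by rewrite s0 ltW.
apply: ceP; rewrite -ball_normE /ball_ /=.
have -> : c - y' = (1 - s)^-1 *: (c + s *: (b - c) - y).
  have -> : c + s *: (b - c) - y = (1 - s) *: c - (y - s *: b).
    by rewrite scalerBl scale1r scalerBr opprB -!addrA; congr (_ + _); rewrite addrCA.
  by rewrite [RHS]scalerBr scalerA mulVf ?gt_eqF // scale1r.
by rewrite normrZ gtr0_norm ?invr_gt0 // mulrC ltr_pdivrMr // mulrC.
Qed.

(** The witness is the supremum of the parameters that stay in [P]: finite as [P] is bounded,
    attained as [P] is closed, and not interior, since otherwise the ray could be followed
    further. *)
Lemma exit_point P c x : closed P -> bounded_set P -> P x -> x != c ->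
  exists2 s, 1 <= s & P (c + s *: (x - c)) /\ ~ P° (c + s *: (x - c)).
Proof.
move=> Pcl [M [_ PM]] Px xc.
have n0 : 0 < `|x - c| by rewrite normr_gt0 subr_eq0.
pose S := [set s : R | P (c + s *: (x - c))].
have S1 : S 1 by rewrite /S /= scale1r addrC subrK.
have ubS : has_ubound S.
  (* From s |x - c| <= |c + s (x - c)| + |c|; the bound on [P] holds for reals strictly above [M],
     whence [M + 1]. *)
  exists ((M + 1 + `|c|) / `|x - c|) => s Ss.
  rewrite ler_pdivlMr //; have := PM (M + 1) _ _ Ss; rewrite ltrDl => /(_ ltr01) le1.
  apply: le_trans (ler_norm _) _; rewrite normrM normr_id -normrZ.
  rewrite -[X in `|X|](addrK c) [X in `|X - c|]addrC.
  by rewrite (le_trans (ler_normB _ _)) // lerD2r.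
have supS : has_sup S by split=> //; exists 1.
exists (sup S); first exact: ub_le_sup.
have shiftE s s' : c + s' *: (x - c) = c + s *: (x - c) - (s - s') *: (x - c).
  by rewrite scalerBl opprB addrCA [c + _]addrC addrK addrC.
split.
  apply: Pcl => B /nbhs_ballP[e /= e0 eB].
  have [s Ss lts] := sup_adherent (divr_gt0 e0 n0) supS.
  exists (c + s *: (x - c)); split=> //; apply: eB.
  rewrite -ball_normE /ball_ /= [X in _ - X](shiftE (sup S)) subKr normrZ.
  have les : s <= sup S by exact: ub_le_sup.
  by rewrite ger0_norm ?subr_ge0 // -ltr_pdivlMr //; lra.
move=> /nbhs_ballP[e /= e0 eP].
(* Moving the parameter by [t] moves the point by [e / 2], which stays in the ball. *)
pose t := e / 2 / `|x - c|.
have t0 : 0 < t by rewrite !divr_gt0.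
have : S (sup S + t).
  apply: eP; rewrite -ball_normE /ball_ /= [X in _ - X](shiftE (sup S)) subKr normrZ.
  rewrite opprD addNKr normrN gtr0_norm // /t divfK ?gt_eqF //; lra.
by move=> /(ub_le_sup ubS); rewrite gerDl leNgt t0.
Qed.

End ConvexBodies.

(** * Convexity and compactness of convex hulls *)

Section ConvexHulls.
Variables (R : realType) (d : nat).
Implicit Types V : {fset 'rV[rat]_d}.

Lemma convex_conv_hull V : convex_set (@conv_hull R d V).
Proof.
move=> _ _ s [lx [lx0 lx1 ->]] [ly [ly0 ly1 ->]] /andP[s0 s1].
exists (fun v => (1 - s) * lx v + s * ly v); split.
- by move=> v Vv; rewrite addr_ge0 ?mulr_ge0 ?lx0 ?ly0 ?subr_ge0.
- by rewrite big_split /= -!mulr_sumr lx1 ly1 !mulr1 subrK.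
- under [RHS]eq_bigr do rewrite scalerDl -!scalerA.
  by rewrite big_split /= -!scaler_sumr.
Qed.

Lemma continuous_sum (T : topologicalType) (U : normedModType R) (I : Type)
    (s : seq I) (F : I -> T -> U) :
  (forall i, continuous (F i)) -> continuous (fun x => \sum_(i <- s) F i x).
Proof.
move=> cF; elim: s => [|i s IHs] x.
  rewrite (_ : (fun _ => _) = fun=> 0); first exact: cvg_cst.
  by apply/funext => y; rewrite big_nil.
rewrite (_ : (fun _ => _) = fun y => F i y + \sum_(j <- s) F j y).
  exact: cvgD (cF i x) (IHs x).
by apply/funext => y; rewrite big_cons.
Qed.

(** The hull is a continuous image of the standard simplex, a closed part of the cube. *)
Lemma compact_conv_hull V : compact (@conv_hull R d V).
Proof.
pose n := size (enum_fset V); pose pt (i : 'I_n) : 'rV[R]_d :=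
  map_mx ratr (nth 0 (enum_fset V) i).
pose S := [set l : 'rV[R]_n | forall i, `[0, 1]%classic (l ord0 i)] `&`
  ((fun l : 'rV[R]_n => \sum_i l ord0 i) @^-1` [set 1]).
have -> : @conv_hull R d V = [set \sum_i l ord0 i *: pt i | l in S].
  apply/seteqP; split=> x.
    move=> [lam [lam0 lam1 ->]].
    have VE (M : nmodType) (F : 'rV[rat]_d -> M) :
        \sum_(v <- V) F v = \sum_(i < n) F (nth 0 (enum_fset V) i).
      by rewrite (big_nth 0) big_mkord.
    exists (\row_i lam (nth 0 (enum_fset V) i)); last first.
      by rewrite VE; apply: eq_bigr => i _; rewrite mxE.
    split=> [i|] /=; last by rewrite -[RHS]lam1 VE; apply: eq_bigr => i _; rewrite mxE.
    have Vi : nth 0 (enum_fset V) i \in V by apply: mem_nth.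
    rewrite mxE in_itv /= lam0 //= -lam1 (big_fsetD1 _ Vi) /= lerDl.
    by rewrite big_seq sumr_ge0 // => v; rewrite !inE => /andP[_ /lam0].
  move=> [l [l01 /= l1] <-].
  (* A vector of coefficients becomes a function on all points, zero outside [V]. *)
  pose lam v := if insub (index v (enum_fset V)) is Some i then l ord0 i else 0.
  have lamE (i : 'I_n) : lam (nth 0 (enum_fset V) i) = l ord0 i.
    by rewrite /lam index_uniq // valK.
  exists lam; split.
  - move=> v _; rewrite /lam; case: insubP => // i _ _.
    by have := l01 i; rewrite /= in_itv /= => /andP[].
  - by rewrite (big_nth 0) big_mkord -[RHS]l1; apply: eq_bigr => i _; rewrite lamE.
  - by rewrite (big_nth 0) big_mkord; apply: eq_bigr => i _; rewrite lamE.
apply: continuous_compact.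
  apply: continuous_subspaceT; apply: continuous_sum => i l.
  exact: cvgZr_tmp (@coord_continuous R 1 n ord0 i l).
apply: compact_closedI.
  exact: (@rV_compact R n (fun=> `[0 : R, 1]%classic) (fun=> @segment_compact R 0 1)).
apply: closed_comp => [l _|]; last exact: closed_eq.
by apply: (@continuous_sum _ R) => i; apply: (@coord_continuous R 1 n ord0 i).
Qed.

End ConvexHulls.

(** * Unique coordinates in the cones from an interior point over boundary simplices *)

Section BoundaryCones.
Variables (R : realType) (d : nat) (P : set 'rV[R]_d).
Variables (T : {fset {fset 'rV[rat]_d}}) (c : 'rV[R]_d).
Hypotheses (Pcvx : convex_set P) (Pcl : closed P) (Pbd : bounded_set P).
Hypotheses (Pc : P° c) (trT : boundary_triangulation P T).
Local Notation pt v := (map_mx (ratr : rat -> R) v).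
Implicit Types (Om Psi : {fset 'rV[rat]_d}) (lam : 'rV[rat]_d -> R) (mu : R).

(** Extending [lam'] by zero, the difference of the two coefficient families is an affine relation
    on [Om]. *)
Lemma aff_indep_inj Om Psi lam lam' : aff_indep R Om -> (Psi `<=` Om)%fset ->
  \sum_(v <- Om) lam v = \sum_(v <- Psi) lam' v ->
  \sum_(v <- Om) lam v *: pt v = \sum_(v <- Psi) lam' v *: pt v ->
  forall v, v \in Om -> lam v = if v \in Psi then lam' v else 0.
Proof.
move=> indOm /fsubsetP sPsi eqs eqp v Omv.
have ext (M : nmodType) (F : 'rV[rat]_d -> M) :
    \sum_(v <- Om) (if v \in Psi then F v else 0) = \sum_(v <- Psi) F v.
  rewrite -big_mkcond /= big_fset_condE; apply: eq_fbigl => x.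
  by rewrite !inE /= andb_idl //; apply: sPsi.
apply/eqP; rewrite -subr_eq0; apply/eqP.
apply: (indOm (fun v => lam v - if v \in Psi then lam' v else 0)) => //.
  by rewrite sumrB eqs ext subrr.
under eq_bigr do rewrite scalerBl (fun_if (fun r => r *: _)) scale0r.
by rewrite sumrB eqp (ext _ (fun v => lam' v *: pt v)) subrr.
Qed.

Lemma boundary_closedE : boundary P = P `\` P°.
Proof. by rewrite /boundary -(closure_id _).1. Qed.

Lemma boundary_relint b : boundary P b -> exists2 Om, Om \in T &
  exists lam, [/\ forall v, v \in Om -> 0 < lam v, \sum_(v <- Om) lam v = 1
    & b = \sum_(v <- Om) lam v *: pt v].
Proof.
case: trT => _ _ closT _ <- [Om /= OmT [lam [lam0 lam1 ->]]].
(* The support of [lam] is the face that has the point in its relative interior. *)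
pose Psi := [fset v in Om | lam v != 0]%fset.
have restr (M : nmodType) (F : 'rV[rat]_d -> M) :
    (forall v, lam v = 0 -> F v = 0) -> \sum_(v <- Om) F v = \sum_(v <- Psi) F v.
  move=> F0; rewrite -big_fset_condE [RHS]big_mkcond; apply: eq_bigr => v _.
  by case: eqP => // /F0.
exists Psi; first by apply: closT OmT _; apply: fset_sub.
exists lam; split.
- by move=> v; rewrite !inE => /andP[/lam0 l0 ln0]; rewrite lt_neqAle eq_sym ln0.
- by rewrite -restr.
- by rewrite -restr // => v ->; rewrite scale0r.
Qed.

Lemma conv_boundary Om lam : Om \in T -> (forall v, v \in Om -> 0 <= lam v) ->
  \sum_(v <- Om) lam v = 1 -> boundary P (\sum_(v <- Om) lam v *: pt v).
Proof.
case: trT => _ _ _ _ <- OmT lam0 lam1.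
by exists Om => //; exists lam.
Qed.

(** The common point lies in the hull of a common face [Psi]; by affine independence its
    coefficients vanish off [Psi], yet all are positive, so [Psi] is both simplices. *)
Lemma relint_inj Om Om' lam lam' : Om \in T -> Om' \in T ->
  (forall v, v \in Om -> 0 < lam v) -> (forall v, v \in Om' -> 0 < lam' v) ->
  \sum_(v <- Om) lam v = 1 -> \sum_(v <- Om') lam' v = 1 ->
  \sum_(v <- Om) lam v *: pt v = \sum_(v <- Om') lam' v *: pt v ->
  Om = Om' /\ forall v, v \in Om -> lam v = lam' v.
Proof.
move=> OmT OmT' lam0 lam0' lam1 lam1' eqp.
case: trT => _ indT _ /(_ Om Om' OmT OmT')[Psi [sOm sOm' capE]] _.
have [mu [mu0 mu1 eqmu]] : conv_hull Psi (\sum_(v <- Om) lam v *: pt v).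
  rewrite -capE; split; first by exists lam; split=> // v /lam0/ltW.
  by exists lam'; split=> // v /lam0'/ltW.
have eqOm (O : {fset 'rV[rat]_d}) l : O \in T -> (Psi `<=` O)%fset ->
    (forall v, v \in O -> 0 < l v) -> \sum_(v <- O) l v = 1 ->
    \sum_(v <- O) l v *: pt v = \sum_(v <- Psi) mu v *: pt v -> Psi = O.
  move=> OT sO l0 l1 eql; apply/eqP; rewrite eqEfsubset sO; apply/fsubsetP => v Ov.
  have := aff_indep_inj (indT _ OT) sO (etrans l1 (esym mu1)) eql Ov.
  by case: ifP => // _ lv0; have := l0 v Ov; rewrite lv0 ltxx.
have E : Psi = Om by apply: eqOm eqmu.
have E' : Psi = Om' by apply: eqOm (etrans (esym eqp) eqmu).
split; first by rewrite -E.
rewrite -E' E in lam1' eqp.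
move=> v Omv; have := aff_indep_inj (indT _ OmT) (fsubset_refl _)
  (etrans lam1 (esym lam1')) eqp Omv.
by rewrite Omv.
Qed.

Lemma cone_point_exists (t : R) p : 0 <= t -> P p -> exists2 Om, Om \in T &
  exists lam mu, [/\ forall v, v \in Om -> 0 < lam v, 0 <= mu,
    \sum_(v <- Om) lam v + mu = t
    & \sum_(v <- Om) lam v *: pt v + mu *: c = t *: p].
Proof.
move=> t0 Pp; have T0 : fset0 \in T by case: trT.
have [t_eq0|tn0] := eqVneq t 0.
  (* The apex and its ray direction belong to the cone over the empty simplex. *)
  exists fset0 => //; exists (fun=> 0), t; rewrite !big_seq_fset0 !add0r.
  by split=> //; rewrite t_eq0 !scale0r.
have [pc|pc] := eqVneq p c.
  exists fset0 => //; exists (fun=> 0), t; rewrite !big_seq_fset0 !add0r.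
  by split=> //; rewrite pc.
have [s s1 [Pb nPb]] := exit_point Pcl Pbd Pp pc.
have s0 : 0 < s by rewrite (lt_le_trans _ s1).
have : boundary P (c + s *: (p - c)) by rewrite boundary_closedE.
move=> /boundary_relint[Om OmT [lam [lam0 lam1 bE]]].
have ts0 : 0 < t / s by rewrite divr_gt0 // lt_neqAle eq_sym tn0.
(* With b = c + s (p - c) the exit point, t p = (t/s) b + (t - t/s) c, and s >= 1 makes the last
   weight nonnegative. *)
exists Om => //; exists (fun v => t / s * lam v), (t - t / s); split.
- by move=> v /lam0 lv0; rewrite mulr_gt0.
- by rewrite subr_ge0 ler_pdivrMr // ler_peMr.
- by rewrite -mulr_sumr lam1 mulr1 addrC subrK.
- under eq_bigr do rewrite -scalerA.
  rewrite -scaler_sumr -bE scalerDr scalerA divfK ?gt_eqF // scalerBr scalerBl.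
  set x := (t / s) *: c.
  by rewrite [x + _]addrC -addrA [x + _]addrC !subrK.
Qed.

Lemma fset0_or_boundary Om lam : Om \in T -> (forall v, v \in Om -> 0 < lam v) ->
  Om = fset0 \/ exists2 b, boundary P b & 0 < \sum_(v <- Om) lam v /\
    \sum_(v <- Om) lam v *: pt v = (\sum_(v <- Om) lam v) *: b.
Proof.
move=> OmT lam0; have [->|[v0 Omv0]] := fset_0Vmem Om; [by left|right].
set s := \sum_(v <- Om) lam v.
have s0 : 0 < s.
  rewrite /s (big_fsetD1 _ Omv0) /= ltr_pwDl ?lam0 // big_seq sumr_ge0 // => v.
  by rewrite !inE => /andP[_ /lam0/ltW].
exists (\sum_(v <- Om) (s^-1 * lam v) *: pt v).
  apply: conv_boundary => // [v /lam0/ltW lv0|].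
    by rewrite mulr_ge0 // invr_ge0 ltW.
  by rewrite -mulr_sumr mulVf // gt_eqF.
split=> //; rewrite scaler_sumr; apply: eq_bigr => v _.
by rewrite scalerA mulVKf // gt_eqF.
Qed.

Lemma cone_point_mem Om lam mu : Om \in T -> (forall v, v \in Om -> 0 < lam v) ->
  0 <= mu -> exists2 p, P p &
  \sum_(v <- Om) lam v *: pt v + mu *: c = (\sum_(v <- Om) lam v + mu) *: p.
Proof.
move=> OmT lam0 mu0; have Pc' := interior_subset Pc.
have [->|[b Pb [s0 ->]]] := fset0_or_boundary OmT lam0.
  by exists c => //; rewrite !big_seq_fset0 !add0r.
set s := \sum_(v <- Om) lam v in s0 *.
have smu0 : 0 < s + mu by rewrite ltr_pwDl.
(* Dividing s b + mu c by its total weight gives a convex combination of two points of [P]. *)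
exists ((1 - mu / (s + mu)) *: b + (mu / (s + mu)) *: c).
  apply: Pcvx => //; first by move: Pb; rewrite boundary_closedE => -[].
  by rewrite divr_ge0 ?(ltW smu0) //= ler_pdivrMr // mul1r lerDr ltW.
rewrite scalerDr !scalerA mulrBr mulr1 mulrCA mulfV ?gt_eqF // mulr1.
by rewrite addrK.
Qed.

(** Subtracting the total weight times [c] leaves s (b - c) with [b] on the boundary, or 0 for the
    empty simplex. A ray from [c] meets the boundary only once, so s and b agree on both sides and
    [relint_inj] concludes. *)
Lemma cone_point_inj Om Om' lam lam' mu mu' : Om \in T -> Om' \in T ->
  (forall v, v \in Om -> 0 < lam v) -> (forall v, v \in Om' -> 0 < lam' v) ->
  \sum_(v <- Om) lam v + mu = \sum_(v <- Om') lam' v + mu' ->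
  \sum_(v <- Om) lam v *: pt v + mu *: c =
    \sum_(v <- Om') lam' v *: pt v + mu' *: c ->
  [/\ Om = Om', forall v, v \in Om -> lam v = lam' v & mu = mu'].
Proof.
move=> OmT OmT' lam0 lam0' eqs eqp.
have bP b : boundary P b -> P b /\ ~ P° b by rewrite boundary_closedE.
have eqX : \sum_(v <- Om) lam v *: pt v - (\sum_(v <- Om) lam v) *: c =
           \sum_(v <- Om') lam' v *: pt v - (\sum_(v <- Om') lam' v) *: c.
  apply: (addIr ((\sum_(v <- Om) lam v + mu) *: c)).
  by rewrite [in RHS]eqs !scalerDl !addrA !subrK.
have lt_absurd s s' b b' : boundary P b -> boundary P b' -> 0 < s -> s < s' ->
    s *: b - s *: c = s' *: b' - s' *: c -> False.
  move=> /bP[Pb _] /bP[_ nPb'] s0 ss' eqb; apply: nPb'.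
  have s0' := lt_trans s0 ss'.
  (* With s < s', [b'] would lie strictly between [c] and [b], hence in the interior. *)
  have -> : b' = c + (s / s') *: (b - c).
    rewrite mulrC -scalerA [s *: _]scalerBr eqb -scalerBr scalerA mulVf ?gt_eqF //.
    by rewrite scale1r addrC subrK.
  apply: interior_segment => //.
  by rewrite divr_ge0 ?ltW //= ltr_pdivrMr // mul1r.
have eqc s b : boundary P b -> 0 < s -> s *: b - s *: c = 0 -> False.
  move=> /bP[_ nPb] s0; rewrite -scalerBr => /eqP; rewrite scaler_eq0 gt_eqF //=.
  by rewrite subr_eq0 => /eqP bc; rewrite bc in nPb.
have [O0|[b Pb [s0 XE]]] := fset0_or_boundary OmT lam0;
    have [O0'|[b' Pb' [s0' XE']]] := fset0_or_boundary OmT' lam0'.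
- rewrite O0 O0' !big_seq_fset0 !add0r in eqs *.
  by split.
- exfalso; apply: (eqc _ _ Pb' s0'); rewrite -XE' -eqX O0 !big_seq_fset0.
  by rewrite scale0r subrr.
- exfalso; apply: (eqc _ _ Pb s0); rewrite -XE eqX O0' !big_seq_fset0.
  by rewrite scale0r subrr.
rewrite XE XE' in eqX.
have ss' : \sum_(v <- Om) lam v = \sum_(v <- Om') lam' v.
  apply/eqP; rewrite eq_le !leNgt; apply/andP; split; apply/negP.
    by move=> lt; apply: lt_absurd Pb' Pb s0' lt (esym eqX).
  by move=> lt; apply: lt_absurd Pb Pb' s0 lt eqX.
have mumu' : mu = mu' by move: eqs; rewrite ss' => /addrI.
rewrite mumu' in eqp; have {}eqp := addIr _ eqp.
set s := \sum_(v <- Om) lam v in s0 ss'.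
(* Dividing by the common weight [s] yields barycentric coordinates. *)
have [| | | | |OO' eql] := @relint_inj Om Om' (fun v => s^-1 * lam v)
  (fun v => s^-1 * lam' v) OmT OmT'.
- by move=> v /lam0 lv0; rewrite mulr_gt0 ?invr_gt0.
- by move=> v /lam0' lv0; rewrite mulr_gt0 ?invr_gt0.
- by rewrite -mulr_sumr mulVf // gt_eqF.
- by rewrite -mulr_sumr -ss' mulVf // gt_eqF.
- under eq_bigr do rewrite -scalerA.
  under [RHS]eq_bigr do rewrite -scalerA.
  by rewrite -!scaler_sumr eqp.
split=> // v /eql; apply: mulfI.
by rewrite invr_eq0 gt_eqF.
Qed.

(* Split the relation into its positive and negative coefficients: the two
   sides are supported on disjoint faces, so both supports are empty. *)
Lemma cone_point_indep Om lam mu : Om \in T ->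
  \sum_(v <- Om) lam v + mu = 0 ->
  \sum_(v <- Om) lam v *: pt v + mu *: c = 0 ->
  (forall v, v \in Om -> lam v = 0) /\ mu = 0.
Proof.
move=> OmT sum0 pt0; have closT Psi : (Psi `<=` Om)%fset -> Psi \in T.
  by case: trT => _ _ closT _ _; apply: closT.
pose Om1 := [fset v in Om | 0 < lam v]%fset.
pose Om2 := [fset v in Om | lam v < 0]%fset.
have split (M : zmodType) (F : 'rV[rat]_d -> M) : (forall v, lam v = 0 -> F v = 0) ->
    \sum_(v <- Om) F v = \sum_(v <- Om1) F v + \sum_(v <- Om2) F v.
  move=> F0; rewrite -!big_fset_condE.
  rewrite [X in _ = X + _]big_mkcond [X in _ = _ + X]big_mkcond -big_split /=.
  by apply: eq_bigr => v _; case: ltgtP => [||/esym/F0] //; rewrite ?addr0 ?add0r.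
have [| | | | | |O12 _ mu0] := @cone_point_inj Om1 Om2 lam (fun v => - lam v) mu 0.
- by apply: closT; apply: fset_sub.
- by apply: closT; apply: fset_sub.
- by move=> v; rewrite !inE => /andP[].
- by move=> v; rewrite !inE oppr_gt0 => /andP[].
- apply/eqP; rewrite addr0 sumrN -addr_eq0 addrAC; apply/eqP.
  by rewrite -(split _ (fun v => lam v)).
- apply/eqP; rewrite scale0r addr0.
  under [X in _ == X]eq_bigr do rewrite scaleNr.
  rewrite sumrN -addr_eq0 addrAC; apply/eqP.
  by rewrite -(split _ (fun v => lam v *: pt v)) // => v ->; rewrite scale0r.
split=> // v Omv; have := congr1 (fun X : {fset 'rV[rat]_d} => v \in X) O12.
by rewrite !inE Omv /=; case: ltgtP.
Qed.

End BoundaryCones.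

(** * The denominator of the triangulation and integrality of the lifts *)

Lemma dvdn_biglcm_seq (I : eqType) (s : seq I) (F : I -> nat) x :
  x \in s -> (F x %| \big[lcmn/1]_(y <- s) F y)%N.
Proof.
elim: s => // y s IHs; rewrite inE big_cons => /predU1P[<-|/IHs xs].
  exact: dvdn_lcml.
exact: dvdn_trans xs (dvdn_lcmr _ _).
Qed.

Lemma biglcm_gt0 (I : Type) (s : seq I) (F : I -> nat) :
  (forall i, 0 < F i)%N -> (0 < \big[lcmn/1]_(i <- s) F i)%N.
Proof. by move=> F0; elim/big_ind: _ => // m n m0 n0; rewrite lcmn_gt0 m0. Qed.

Lemma denominator_gt0 d (T : {fset {fset 'rV[rat]_d}}) : (0 < denominator T)%N.
Proof. by do 3![apply: biglcm_gt0 => ?]; rewrite absz_gt0 denq_neq0. Qed.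

(** The denominator of each vertex coordinate divides that of [T], so the scaled coordinate is an
    integer and equals its own numerator. *)
Lemma numq_denominator d (T : {fset {fset 'rV[rat]_d}}) Om v i :
  Om \in T -> v \in Om ->
  (numq ((denominator T)%:R * v 0 i))%:~R = (denominator T)%:R * v 0 i.
Proof.
move=> OmT Omv; have : (absz (denq (v 0%R i)) %| denominator T)%N.
  apply: dvdn_trans (dvdn_biglcm_seq _ OmT); apply: dvdn_trans (dvdn_biglcm_seq _ Omv).
  by apply: dvdn_biglcm_seq; rewrite mem_index_enum.
move=> /dvdnP[k ->].
suff -> : (k * absz (denq (v 0 i)))%:R * v 0 i = (k%:Z * numq (v 0 i))%:~R.
  by rewrite numq_int.
rewrite natrM rmorphM /= numqE -pmulrn -mulrA; congr (_ * _); rewrite mulrC.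
by rewrite -[in RHS](gez0_abs (ltW (denq_gt0 _))).
Qed.

Lemma last_coord_lift d (a : 'rV[int]_d) l : last_coord (lift_point a l) = l%:Z.
Proof. by rewrite /last_coord /lift_point row_mxEr mxE. Qed.

Lemma lift_pointK d (y : 'rV[int]_(d + 1)) (t : nat) :
  level t y -> y = lift_point (lsubmx y) t.
Proof.
rewrite /level /last_coord /lift_point /= => yt; rewrite -[LHS]hsubmxK; congr row_mx.
by apply/matrixP => i j; rewrite !mxE !ord1 yt.
Qed.

(** * The lifted cones, the Ehrhart series and the expansion of each cone *)

Section LiftedCones.
Variables (R : realType) (d : nat) (P : set 'rV[R]_d).
Variables (T : {fset {fset 'rV[rat]_d}}) (a : 'rV[int]_d) (l : nat).
Hypotheses (Pcvx : convex_set P) (Pcl : closed P) (Pbd : bounded_set P).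
Hypotheses (l_gt0 : (0 < l)%N) (Pc : P° (l%:R^-1 *: map_mx intr a)).
Hypothesis trT : boundary_triangulation P T.
Local Notation E := 'rV[int]_(d + 1).
Local Notation z := (fpsX rat).
Local Notation pt v := (map_mx (ratr : rat -> R) v).
Local Notation ev w := (map_mx (intr : int -> R) w).
Local Notation q := (denominator T).
Local Notation a' := (lift_point a l).
Let c : 'rV[R]_d := l%:R^-1 *: ev a.
Implicit Types (Om Psi : {fset 'rV[rat]_d}).

Let q_gt0 : (0 < q)%N := denominator_gt0 T.
Let q_neq0 : q%:R != 0 :> R. Proof. by rewrite pnatr_eq0 -lt0n. Qed.
Let l_neq0 : l%:R != 0 :> R. Proof. by rewrite pnatr_eq0 -lt0n. Qed.

Let lift (v : 'rV[rat]_d) : E := lift_point (map_mx (fun x => numq (q%:R * x)) v) q.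
Let unlift (w : E) : 'rV[rat]_d := q%:R^-1 *: map_mx intr (lsubmx w).

Lemma liftK Om : Om \in T -> {in Om, cancel lift unlift}.
Proof.
move=> OmT v Omv; apply/rowP => i; rewrite /unlift /lift /lift_point row_mxKl !mxE.
by rewrite (numq_denominator _ OmT) // mulKf // pnatr_eq0 -lt0n.
Qed.

Lemma lift_inj Om : Om \in T -> {in Om &, injective lift}.
Proof. by move=> /liftK; apply: can_in_inj. Qed.

Lemma ev_lift_point (b : 'rV[int]_d) (k : nat) :
  ev (lift_point b k) = row_mx (ev b) (const_mx k%:R).
Proof. by rewrite map_row_mx map_const_mx. Qed.

Lemma ev_lift Om v : Om \in T -> v \in Om ->
  ev (lift v) = row_mx (q%:R *: pt v) (const_mx q%:R).
Proof.
move=> OmT Omv; rewrite ev_lift_point; congr row_mx; apply/rowP => i.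
rewrite !mxE -(ratr_int R) (numq_denominator _ OmT) // rmorphM /=.
by rewrite ratr_nat.
Qed.

Lemma ev_apex : ev a' = row_mx (l%:R *: c) (const_mx l%:R).
Proof. by rewrite ev_lift_point /c scalerA divff // scale1r. Qed.

Lemma sum_row_const (I : Type) (s : seq I) (b : I -> R) (A : I -> 'rV[R]_d) :
  \sum_(i <- s) row_mx (A i) (const_mx (b i)) =
  row_mx (\sum_(i <- s) A i) (const_mx (\sum_(i <- s) b i)) :> 'rV[R]_(d + 1).
Proof.
elim: s => [|i s IHs]; first by rewrite !big_nil row_mx0.
rewrite !big_cons IHs add_row_mx; congr row_mx.
by apply/matrixP => ? ?; rewrite !mxE.
Qed.

(** A coefficient on the lift (q v, q) is [q] times as large when read as a weight on [v]; this
    translates between cones and weighted points. *)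
Lemma sum_lift Om (nu : E -> R) : Om \in T ->
  \sum_(w <- (lift @` Om)%fset) nu w *: ev w =
  row_mx (\sum_(v <- Om) (q%:R * nu (lift v)) *: pt v)
         (const_mx (\sum_(v <- Om) q%:R * nu (lift v))).
Proof.
move=> OmT; rewrite big_imfset /=; last exact: lift_inj.
rewrite -sum_row_const; apply: eq_big_seq => v Omv.
rewrite (ev_lift OmT) // scale_row_mx scalerA mulrC; congr row_mx.
by apply/matrixP => ? ?; rewrite !mxE mulrC.
Qed.

Lemma ev_split (y : E) : ev y = row_mx (ev (lsubmx y)) (const_mx (last_coord y)%:~R).
Proof.
rewrite -[in LHS](hsubmxK y) map_row_mx; congr row_mx.
by apply/matrixP => i j; rewrite !mxE !ord1.
Qed.

Lemma apex_notin Om : Om \in T -> a' \notin (lift @` Om)%fset.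
Proof.
move=> OmT; apply/imfsetP => -[v /= Omv a'E].
have vT : [fset v]%fset \in T.
  by case: trT => _ _ closT _ _; apply: closT OmT _; rewrite fsub1set.
have := ev_apex; rewrite a'E (ev_lift OmT) // => /eq_row_mx[eqv eqc].
have ql : q%:R = l%:R :> R by move/matrixP: eqc => /(_ 0 0); rewrite !mxE.
(* A vertex with the same lift as the apex would equal [c], giving the forbidden relation v - c =
   0. *)
have [|||/(_ v)] := @cone_point_indep R d P T c Pcvx Pcl Pc trT [fset v]%fset (fun=> 1) (-1).
- by [].
- by rewrite big_seq_fset1 subrr.
- rewrite big_seq_fset1 scale1r scaleN1r; apply/eqP; rewrite subr_eq0; apply/eqP.
  by apply: (scalerI l_neq0); rewrite -eqv ql.
by rewrite inE eqxx => /(_ isT)/eqP; rewrite oner_eq0.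
Qed.

Lemma lin_indep_apex_lift Om : Om \in T -> lin_indep R (a' |` lift @` Om)%fset.
Proof.
move=> OmT nu; rewrite big_fsetU1 ?apex_notin //= sum_lift // ev_apex.
rewrite scale_row_mx add_row_mx -row_mx0 => /eq_row_mx[eqp eqs].
have {}eqs : l%:R * nu a' + \sum_(v <- Om) q%:R * nu (lift v) = 0.
  by move/matrixP: eqs => /(_ 0 0); rewrite !mxE mulrC.
have [|||nu0 nua0] := @cone_point_indep R d P T c Pcvx Pcl Pc trT Om
  (fun v => q%:R * nu (lift v)) (l%:R * nu a').
- by [].
- by rewrite addrC.
- by rewrite addrC mulrC -scalerA.
move=> w; rewrite !inE => /predU1P[->|/imfsetP[v /= Omv ->]].
  by apply: (mulfI l_neq0); rewrite nua0 mulr0.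
by apply: (mulfI q_neq0); rewrite nu0 ?mulr0.
Qed.

Lemma pos_heights_apex_lift Om : pos_heights (a' |` lift @` Om)%fset.
Proof.
move=> w; rewrite !inE => /predU1P[->|/imfsetP[v /= Omv ->]].
  by rewrite last_coord_lift.
by rewrite last_coord_lift.
Qed.

Lemma pos_heights_lift Om : pos_heights (lift @` Om)%fset.
Proof. by move=> w Ww; apply: (@pos_heights_apex_lift Om); rewrite !inE Ww orbT. Qed.

(** The two pieces are the cases mu = 0 and mu > 0 of the apex coefficient. *)
Definition apex_cone Om : set E := halfopen R (lift @` Om)%fset fset0 `|`
  halfopen R (a' |` lift @` Om)%fset fset0.

Lemma apex_coneP Om y : Om \in T -> apex_cone Om y <->
  exists lam mu, [/\ forall v, v \in Om -> 0 < lam v, 0 <= mu,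
    \sum_(v <- Om) lam v + mu = (last_coord y)%:~R
    & \sum_(v <- Om) lam v *: pt v + mu *: c = ev (lsubmx y)].
Proof.
have q0 : 0 < q%:R :> R by rewrite ltr0n.
have l0 : 0 < l%:R :> R by rewrite ltr0n.
move=> OmT; split.
  case=> -[nu [nu0 _]].
    rewrite sum_lift // ev_split => /eq_row_mx[-> eqs].
    exists (fun v => q%:R * nu (lift v)), 0; rewrite addr0 scale0r addr0; split=> //.
      by move=> v Omv; rewrite mulr_gt0 // nu0 // in_imfset.
    by move/matrixP: eqs => /(_ 0 0); rewrite !mxE.
  rewrite big_fsetU1 ?apex_notin //= sum_lift // ev_apex ev_split.
  rewrite scale_row_mx add_row_mx => /eq_row_mx[-> eqs].
  exists (fun v => q%:R * nu (lift v)), (nu a' * l%:R); split=> //.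
  - by move=> v Omv; rewrite mulr_gt0 // nu0 // !inE in_imfset ?orbT.
  - by rewrite mulr_ge0 ?ltW // nu0 // !inE eqxx.
  - by move/matrixP: eqs => /(_ 0 0); rewrite !mxE addrC.
  - by rewrite addrC scalerA.
move=> [lam [mu [lam0 mu0 eqs eqp]]].
(* Weights refer to points at height 1, whereas the generators have heights [l] and [q]. *)
pose nu w := if w == a' then mu / l%:R else q%:R^-1 * lam (unlift w).
have nuE v : v \in Om -> q%:R * nu (lift v) = lam v.
  move=> Omv; rewrite /nu ifN ?(liftK OmT) ?mulVKf //.
  apply: contra (apex_notin OmT) => /eqP <-; exact: in_imfset.
have nu0 w : w \in (lift @` Om)%fset -> 0 < nu w.
  by move=> /imfsetP[v /= Omv ->]; rewrite -(pmulr_rgt0 _ q0) nuE ?lam0.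
have sumE : \sum_(w <- (lift @` Om)%fset) nu w *: ev w =
    row_mx (\sum_(v <- Om) lam v *: pt v) (const_mx (\sum_(v <- Om) lam v)).
  rewrite sum_lift //; congr row_mx; first by apply: eq_big_seq => v /nuE ->.
  by congr const_mx; apply: eq_big_seq => v /nuE ->.
have [mu_eq0|mun0] := eqVneq mu 0; [left|right]; exists nu; split=> //.
- rewrite sumE ev_split -eqp -eqs mu_eq0.
  by rewrite scale0r !addr0.
- move=> w; rewrite !inE => /predU1P[->|/nu0//].
  by rewrite /nu eqxx divr_gt0 // lt_neqAle eq_sym mun0.
- rewrite big_fsetU1 ?apex_notin //= sumE ev_apex ev_split -eqp -eqs.
  rewrite /nu eqxx scale_row_mx add_row_mx scalerA divfK // addrC; congr row_mx.
  by apply/matrixP => ? ?; rewrite !mxE divfK // addrC.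
Qed.

Lemma graded_apex_cone Om : graded (apex_cone Om).
Proof.
apply: gradedU; apply: graded_halfopen.
  exact: pos_heights_lift.
exact: pos_heights_apex_lift.
Qed.

Lemma apex_cone_disjoint Om Om' : Om \in T -> Om' \in T ->
  apex_cone Om `&` apex_cone Om' !=set0 -> Om = Om'.
Proof.
move=> OmT OmT' [y [/(apex_coneP _ OmT)[lam [mu [lam0 mu0 eqs eqp]]]]].
move=> /(apex_coneP _ OmT')[lam' [mu' [lam0' mu0' eqs' eqp']]].
have [] // := @cone_point_inj R d P T c Pcvx Pcl Pc trT Om Om' lam lam' mu mu'.
  by rewrite eqs eqs'.
by rewrite eqp eqp'.
Qed.

(** Lattice points of tP are the height [t] points of the cone over [P], which the apex cones
    partition. *)
Lemma Ehr_apex_cones : Ehr P = \sum_(Om <- T) gf (apex_cone Om).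
Proof.
have [||gU <-] := @graded_gf_bigcup d _ (enum_fset T) apex_cone (fset_uniq _).
- by move=> Om _; apply: graded_apex_cone.
- exact: apex_cone_disjoint.
set U := [set v | _] in gU *.
apply/fpsP => t /=; congr _%:R; rewrite /lattice_count.
have -> : [set v : 'rV[int]_d | [set t%:R *: x | x in P] (ev v)] =
          [set lsubmx y | y in U `&` level t].
  apply/seteqP; split=> v.
    move=> [p Pp tpE]; exists (lift_point v t); last by rewrite row_mxKl.
    split; last exact: last_coord_lift.
    have [Om OmT [lam [mu [lam0 mu0 eqs eqp]]]] :=
      cone_point_exists c Pcl Pbd trT (ler0n _ t) Pp.
    exists Om => //; apply/apex_coneP => //; exists lam, mu; split=> //.
      by rewrite last_coord_lift.
    by rewrite row_mxKl eqp.
  move=> [y [[Om OmT /(apex_coneP _ OmT)[lam [mu [lam0 mu0 eqs eqp]]]] yt] <-].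
  have [p Pp pE] := cone_point_mem Pcvx Pcl Pc trT OmT lam0 mu0.
  by exists p => //; rewrite -eqp pE eqs yt.
(* On one level, forgetting the last coordinate is injective. *)
have fU := gU.2 t; rewrite fset_set_image // card_in_imfset //= => y y'.
rewrite !in_fset_set // !inE => -[_ yt] [_ yt'] eqy.
by rewrite (lift_pointK yt) (lift_pointK yt') eqy.
Qed.

Lemma gf_apex_cone Om : Om \in T -> (1 - z ^+ l) * gf (apex_cone Om) =
  \sum_(Psi <- fpowerset Om)
    (1 - z ^+ q)^-1 ^+ #|` Psi| * (z ^+ q / (1 - z ^+ q)) ^+ (#|` Om| - #|` Psi|) *
    (box_series R (lift_simplex q Psi) z
     + box_series R (a' |` lift_simplex q Psi)%fset z).
Proof.
move=> OmT; have aW := apex_notin OmT; have ind := lin_indep_apex_lift OmT.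
have posW := @pos_heights_lift Om; have posaW := @pos_heights_apex_lift Om.
rewrite /apex_cone gfU; try exact: graded_halfopen; last first.
  apply/seteqP; split=> // y [[lam [lam0 _ yE]] [lam' [lam0' _ yE']]].
  have aaW : a' \in (a' |` lift @` Om)%fset by rewrite !inE eqxx.
  have := sum_update lam 0 aW; rewrite scale0r add0r -yE yE' => eqs.
  have := lin_indep_inj ind eqs aaW; rewrite eqxx => lam'0.
  by have := lam0' _ aaW; rewrite -lam'0 ltxx.
rewrite mulrDr (gf_halfopen_split aW (fsub0set _) ind posaW (last_coord_lift _ _)).
(* The z^l terms of the two pieces cancel, leaving the cone without apex and the cone whose apex
   coefficient is cut at 1. *)
rewrite fsetU0 mulrBl mul1r addrA addrAC subrK.
have expand A (fA : forall v, v \in Om -> lift v \notin A) :=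
  gf_halfopen_expand (lift_inj OmT) fA q_gt0 (fun v _ => last_coord_lift _ q).
(* The expansion is used with nothing cut and with the apex cut; these give B(Psi) and B(Psi')
   respectively. *)
rewrite -[X in gf (halfopen _ X _) + _]fset0U !expand //.
- rewrite -big_split /=; apply: eq_bigr => Psi _; rewrite -mulrDr fset0U.
  by rewrite !box_series_gf //; [apply: pos_heights_apex_lift | apply: pos_heights_lift].
- by move=> v Omv; rewrite inE; apply: contra aW => /eqP <-; apply: in_imfset.
- by move=> w; rewrite inE => /eqP->; rewrite last_coord_lift.
- by apply: sub_lin_indep ind; rewrite fset0U fsubsetUr.
Qed.

End LiftedCones.

(** * The h-polynomials and the final exchange of sums *)

(** The exponent d - 1 - dim is d minus the number of vertices; taking out only the power [d] leaves
    exactly the weights of [gf_halfopen_expand]. *)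
Lemma hpoly_fpsE d (T : {fset {fset 'rV[rat]_d}}) Psi (x : fps rat) :
  1 - x \is a GRing.unit -> hpoly T Psi x = (1 - x) ^+ d *
    \sum_(Om <- T | (Psi `<=` Om)%fset)
      (1 - x)^-1 ^+ #|` Psi| * (x / (1 - x)) ^+ (#|` Om| - #|` Psi|).
Proof.
move=> ux; rewrite /hpoly /sdim -mulr_sumr mulrA; congr (_ * _).
  rewrite (_ : _ - _ = d%:Z + - (#|` Psi|)%:Z); last by lia.
  by rewrite exprzDr // exprVn -invr_expz.
apply: eq_bigr => Om /fsubset_leq_card le_card.
by rewrite (_ : _ - _ = (#|` Om| - #|` Psi|)%N%:Z) //; lia.
Qed.

Theorem theorem4p4 (R : realType) (d : nat) (P : set 'rV[R]_d)
    (a : 'rV[int]_d) (l : nat) (T : {fset {fset 'rV[rat]_d}}) (q : nat)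
    (hstar : fps rat) :
  rational_dpolytope P ->
  (0 < l)%N ->
  interior P (l%:R^-1 *: map_mx intr a) ->
  boundary_triangulation P T ->
  q = denominator T ->
  Ehr P = hstar / (1 - fpsX rat ^+ q) ^+ d.+1 ->
  hstar = (1 - fpsX rat ^+ q) / (1 - fpsX rat ^+ l) *
    \sum_(Om <- T)
      (box_series R (lift_simplex q Om) (fpsX rat)
       + box_series R (lift_point a l |` lift_simplex q Om)%fset (fpsX rat))
      * hpoly T Om (fpsX rat ^+ q).
Proof.
move=> [V [PV _]] l_gt0 Pc trT -> EhrE.
have Pcvx : convex_set P by rewrite PV; apply: convex_conv_hull.
have Pcpt : compact P by rewrite PV; apply: compact_conv_hull.
have Pcl : closed P by apply: compact_closed Pcpt; apply: norm_hausdorff.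
have Pbd := compact_bounded Pcpt.
have closT (Om Psi : {fset 'rV[rat]_d}) : Om \in T -> (Psi `<=` Om)%fset -> Psi \in T.
  by case: trT => _ _ closT _ _; apply: closT.
have uq := unit_subXn rat (denominator_gt0 T); have ul := unit_subXn rat l_gt0.
have -> : hstar = Ehr P * (1 - fpsX rat ^+ denominator T) ^+ d.+1.
  by rewrite EhrE divrK // unitrX.
under eq_bigr do rewrite hpoly_fpsE // mulrCA.
rewrite -mulr_sumr; set S := \sum_(Om <- T) _.
(* The factor (1 - z^q)^d common to all h-polynomials is out of the sum; with the prefactor it
   restores the power d + 1. *)
suff <- : (1 - fpsX rat ^+ l) * Ehr P = S.
  rewrite exprS -[in RHS]mulrA [_^-1 * _]mulrCA mulKr //.
  by rewrite mulrC -mulrA.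
rewrite (Ehr_apex_cones Pcvx Pcl Pbd l_gt0 Pc trT) mulr_sumr.
rewrite (eq_big_seq _ (gf_apex_cone Pcvx Pcl l_gt0 Pc trT)) /S.
under [RHS]eq_bigr do rewrite mulr_sumr.
(* Summing over the larger simplex first, the inner sum runs over its faces in [T], which are all
   its subsets. *)
rewrite (exchange_big_dep xpredT) //=; apply: eq_big_seq => Om OmT.
rewrite [RHS]big_fset_condE /=.
have -> : [fset Psi in T | (Psi `<=` Om)%fset]%fset = fpowerset Om.
  by apply/fsetP => Psi; rewrite !inE fpowersetE /= andb_idl //; apply: closT.
by apply: eq_bigr => Psi _; rewrite mulrC.
Qed.
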